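(* Let $\varphi$ be a substitution on a finite alphabet $\mathcal{A}$. The following are equivalent: (1) $\varphi$ is wild; (2) $\varphi$ has property $(\ast)$.
   Context: For a finite alphabet $\mathcal{A}$, $\mathcal{A}^+$ is the set of non-empty finite words. A substitution on $\mathcal{A}$ is a function $\varphi:\mathcal{A}\to\mathcal{A}^+$, extended to words by concatenation; $|u|$ is the length of $u$. A word is admitted by $\varphi$ if it is a subword (block of consecutive letters) of $\varphi^k(a)$ for some $a\in\mathcal{A}$, $k\ge 0$. The subshift $X_\varphi\subset\mathcal{A}^{\mathbb{Z}}$ is the set of bi-infinite sequences all of whose finite subwords are admitted. A word is legal if it is a subword of some element of $X_\varphi$. A word $u\in\mathcal{A}^+$ is bounded (with respect to $\varphi$) if there is $M\in\mathbb{N}$ with $|\varphi^n(u)|\le M$ for all $n\in\mathbb{N}$, and expanding otherwise. $\mathcal{A}_B$ and $\mathcal{A}_\infty$ denote the sets of bounded and expanding letters. Let $B$ be the set of bounded legal words; $\varphi$ is tame if $B$ is finite and wild if $B$ is infinite. $\mathcal{A}_{right}\subset\mathcal{A}_\infty$ is the set of expanding letters $a$ such that the rightmost letter of $\varphi(a)$ is bounded; $\mathcal{A}_{left}\subset\mathcal{A}_\infty$ is the set of expanding letters $a$ such that the leftmost letter of $\varphi(a)$ is bounded. $\varphi$ has property $(\ast)$ if either there exist a letter $a\in\mathcal{A}_{right}$ and an increasing sequence of integers $N_1<N_2<\cdots$ such that for all $i\ge1$ the rightmost expanding letter appearing in $\varphi^{N_i}(a)$ is in $\mathcal{A}_{right}$,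 or there exist a letter $a\in\mathcal{A}_{left}$ and an increasing sequence of integers $N_1<N_2<\cdots$ such that for all $i\ge1$ the leftmost expanding letter appearing in $\varphi^{N_i}(a)$ is in $\mathcal{A}_{left}$. (The exponents $N_i$ are non-negative.) *)

(* Defs.v *)
From mathcomp Require Import all_boot all_order all_algebra.
From mathcomp Require Import classical_sets cardinality.

Set Implicit Arguments.
Unset Strict Implicit.
Unset Printing Implicit Defensive.

Import GRing.Theory.
Local Open Scope classical_set_scope.

Record substitution (A : finType) := Substitution {
  subst_fun :> A -> seq A;
  subst_neq_nil : forall a, subst_fun a != [::] }.

Definition subst_word (A : finType) (phi : substitution A) (w : seq A) :
  seq A := flatten [seq phi a | a <- w].

Definition subst_iter (A : finType) (phi : substitution A) (n : nat)
  (w : seq A) : seq A := iter n (subst_word phi) w.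

Definition admitted (A : finType) (phi : substitution A) : set (seq A) :=
  [set u | exists (a : A) (k : nat), infix u (subst_iter phi k [:: a])].

(* The block x_i x_(i+1) ... x_(i+n-1). *)
Definition block (A : finType) (x : int -> A) (i : int) (n : nat) : seq A :=
  mkseq (fun j => x (i + j%:Z)%R) n.

Definition subshift (A : finType) (phi : substitution A) : set (int -> A) :=
  [set x | forall i n, admitted phi (block x i n)].

Definition legal (A : finType) (phi : substitution A) : set (seq A) :=
  [set u | exists2 x, subshift phi x & exists i n, u = block x i n].

Definition bounded_word (A : finType) (phi : substitution A) : set (seq A) :=
  [set u | u != [::] /\ exists M, forall n, size (subst_iter phi n u) <= M].

Definition expanding_word (A : finType) (phi : substitution A) :
  set (seq A) := [set u | u != [::] /\ ~ bounded_word phi u].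

Definition bounded_letter (A : finType) (phi : substitution A) : set A :=
  [set a | bounded_word phi [:: a]].

Definition expanding_letter (A : finType) (phi : substitution A) : set A :=
  [set a | expanding_word phi [:: a]].

Definition bounded_legal (A : finType) (phi : substitution A) :
  set (seq A) := bounded_word phi `&` legal phi.

Definition tame (A : finType) (phi : substitution A) : Prop :=
  finite_set (bounded_legal phi).

Definition wild (A : finType) (phi : substitution A) : Prop :=
  infinite_set (bounded_legal phi).

(* As phi a is never empty, the default value given to last and head below
   is never returned. *)
Definition A_right (A : finType) (phi : substitution A) : set A :=
  [set a | expanding_letter phi a /\ bounded_letter phi (last a (phi a))].

Definition A_left (A : finType) (phi : substitution A) : set A :=
  [set a | expanding_letter phi a /\ bounded_letter phi (head a (phi a))].

Definition rightmost_expanding (A : finType) (phi : substitution A)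
  (w : seq A) (b : A) : Prop :=
  exists u v, [/\ w = u ++ b :: v, expanding_letter phi b
    & forall c, c \in v -> ~ expanding_letter phi c].

Definition leftmost_expanding (A : finType) (phi : substitution A)
  (w : seq A) (b : A) : Prop :=
  exists u v, [/\ w = u ++ b :: v, expanding_letter phi b
    & forall c, c \in u -> ~ expanding_letter phi c].

Definition star_right (A : finType) (phi : substitution A) : Prop :=
  exists2 a, A_right phi a &
  exists2 N : nat -> nat, {homo N : i j / i < j} &
  forall i, exists2 b,
    rightmost_expanding phi (subst_iter phi (N i) [:: a]) b & A_right phi b.

Definition star_left (A : finType) (phi : substitution A) : Prop :=
  exists2 a, A_left phi a &
  exists2 N : nat -> nat, {homo N : i j / i < j} &
  forall i, exists2 b,
    leftmost_expanding phi (subst_iter phi (N i) [:: a]) b & A_left phi b.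

Definition property_star (A : finType) (phi : substitution A) : Prop :=
  star_right phi \/ star_left phi.

(* Main.v *)
Require Import Defs.
From mathcomp Require Import all_boot all_order all_algebra.
From mathcomp Require Import zify.
From mathcomp Require Import boolp classical_sets cardinality.

Set Implicit Arguments.
Unset Strict Implicit.
Unset Printing Implicit Defensive.

(** Write r(a) for the rightmost expanding letter of phi(a) when a is expanding.
Bounded letters only produce bounded letters, so the rightmost expanding letter
of phi^n(a) is r^n(a); as the alphabet is finite, the r-orbit of a is
eventually periodic.  Hence the right half of property star says exactly that
some expanding letter b whose image ends in a bounded letter is periodic under
r ([star_right_periodic]).  The left half is the same statement for the
substitution with reversed images.

Star implies wild.  If r^p(b) = b, then phi^p(b) = P b T with T bounded and
nonempty, so phi^(np)(b) ends in T psi(T) ... psi^(n-1)(T), with psi = phi^p.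
The lengths of the words psi^k(T) are bounded, hence two of them coincide and
the sequence psi^k(T) is eventually periodic in k: all powers of some nonempty
bounded word w are admitted ([periodic_right_powers]).  The bi-infinite
repetition of w then lies in the subshift, and its blocks are bounded legal
words of every length ([wild_of_powers]).

Wild implies star.  Assume star fails.  Then after #|A| steps the orbit of an
expanding letter a under r avoids the letters whose image ends in a bounded
letter, so nothing new is added to the bounded tail T_n of phi^n(a):
T_(n+1) = phi(T_n), and the lengths of the tails are bounded
([bounded_tail_bounded]); the same holds for bounded prefixes.
A bounded run in phi^(k+1)(a), which is the concatenation of the words
phi^k(c) for c in phi(a), is either inside one phi^k(c) or is a
bounded suffix of one of them, followed by some complete ones and a bounded
prefix of the next; so its length is bounded uniformly in k
([run_bounded]).  There are thus finitely many bounded admitted words, and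
legal words are admitted. *)

(** * Finiteness and periodicity *)

Lemma iter_periodic (T : finType) (f : T -> T) (x : T) (n : nat) :
  #|T| <= n -> exists2 p, 0 < p & iter p f (iter n f x) = iter n f x.
Proof.
move=> leTn; have /trajectP[m ltm eqm] := looping_order f x.
exists (order f x - m); first by rewrite subn_gt0.
have ltmn : m <= n.
  by apply: leq_trans leTn; apply: leq_trans (ltnW ltm) _; apply: max_card.
have -> : iter n f x = iter (n - m) f (iter m f x) by rewrite -iterD subnK.
by rewrite -iterD addnC iterD -(iterD (_ - m) m) subnK ?eqm // ltnW.
Qed.

Lemma fin_uniform_bound (T : finType) (P : pred T) (f : T -> nat -> nat) :
    (forall a, P a -> exists M, forall n, f a n <= M) ->
  exists M, forall a n, P a -> f a n <= M.
Proof.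
move=> bound_f.
have /fin_all_exists[g gP] a : exists M, forall n, P a -> f a n <= M.
  case Pa: (P a); last by exists 0.
  by have [M MP] := bound_f a Pa; exists M.
exists (\max_a g a) => a n Pa.
by apply: leq_trans (gP a n Pa) _; apply: leq_bigmax.
Qed.

Lemma finite_short_words (A : finType) (D : nat) :
  finite_set [set w : seq A | size w <= D].
Proof.
have fin : finite_set [set: D.-bseq A] by exact: finite_finset.
apply: sub_finite_set (finite_image (fun t : D.-bseq A => t : seq A) fin).
by move=> w /= lew; exists (Bseq lew).
Qed.

Lemma bounded_sequence_repeats (A : finType) (f : nat -> seq A) (M : nat) :
  (forall n, size (f n) <= M) -> exists i j, i < j /\ f i = f j.
Proof.
move=> lefM; apply: contrapT => norep.
have inj : injective f.
  move=> i j eqf; apply/eqP; case: (ltngtP i j) => // lt; case: norep.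
    by exists i, j.
  by exists j, i.
have /= := @finite_preimage _ _ [set w : seq A | size w <= M] f.
move/(_ (in2W inj) (finite_short_words A M)).
suff -> : (f @^-1` [set w | size w <= M] = setT)%classic by apply: infinite_nat.
by apply/seteqP; split=> // n _; exact: lefM.
Qed.

(** * Runs in concatenations of words *)

Lemma prefix_cat_split (T : eqType) (u s t : seq T) : prefix u (s ++ t) ->
  prefix u s \/ exists2 u2, u = s ++ u2 & prefix u2 t.
Proof.
elim: s u => [|x s IHs] [|y u] //=; try by [left].
  by right; exists (y :: u).
case/andP=> /eqP-> /IHs[pre|[u2 -> pre]]; first by left; rewrite eqxx.
by right; exists u2.
Qed.

Lemma infix_cat_split (T : eqType) (u s t : seq T) : infix u (s ++ t) ->
  [\/ infix u s, infix u t |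
      exists u1 u2, [/\ u = u1 ++ u2, suffix u1 s & prefix u2 t]].
Proof.
elim: s => [|x s IHs]; first by constructor 2.
rewrite cat_cons infix_consl -cat_cons => /orP[/prefix_cat_split[]|/IHs].
- by move/prefixW; constructor 1.
- case=> u2 -> pre; constructor 3; exists (x :: s), u2; split=> //.
  exact: suffix_refl.
case=> [inf|inf|[u1 [u2 [-> suf pre]]]].
- by constructor 1; rewrite infix_consl inf orbT.
- by constructor 2.
constructor 3; exists u1, u2; split=> //.
by apply: suffix_trans suf _; apply: suffix_cons.
Qed.

Section Runs.
Variables (T : eqType) (P : pred T) (C : nat).

Lemma flatten_prefix_run_bound (ss : seq (seq T)) u :
    (forall s, s \in ss -> forall v, all P v -> prefix v s -> size v <= C) ->
  all P u -> prefix u (flatten ss) -> size u <= C * size ss.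
Proof.
elim: ss u => [|s ss IHss] u preC Pu /=.
  by case: u Pu.
rewrite mulnS; case/prefix_cat_split=> [pre|[u2 def_u pre]].
  by rewrite (leq_trans (preC s _ u Pu pre)) ?mem_head ?leq_addr.
rewrite def_u all_cat in Pu *; case/andP: Pu => Ps Pu2.
rewrite size_cat leq_add //; first by rewrite (preC s) ?mem_head ?prefix_refl.
by apply: IHss => // s' ss's' ; apply: preC; rewrite inE ss's' orbT.
Qed.

(** A run that is not inside a single factor meets each factor in a prefix or a
suffix of it, hence in at most C letters. *)
Lemma flatten_run_bound (ss : seq (seq T)) (D : nat) u :
    (forall s, s \in ss ->
       forall v, all P v -> prefix v s \/ suffix v s -> size v <= C) ->
    (forall s, s \in ss -> forall v, all P v -> infix v s -> size v <= D) ->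
  C * size ss <= D -> all P u -> infix u (flatten ss) -> size u <= D.
Proof.
elim: ss => [|s ss IHss] /= endsC infD leD Pu; first by case: u Pu.
have ss_s s' : s' \in ss -> s' \in s :: ss by rewrite inE orbC => ->.
case/infix_cat_split=> [inf|inf|[u1 [u2 [def_u suf pre]]]].
- by apply: infD inf => //; rewrite mem_head.
- apply: IHss inf => // [s' /ss_s/endsC|s' /ss_s/infD|] //.
  by apply: leq_trans leD; rewrite leq_mul2l leqnSn orbT.
apply: leq_trans leD; rewrite mulnS.
move: Pu; rewrite def_u all_cat size_cat => /andP[Pu1 Pu2].
apply: leq_add; first by apply: (endsC s); rewrite ?mem_head //; right.
apply: flatten_prefix_run_bound pre => // s' /ss_s/endsC endsC' v Pv pre.
by apply: endsC' => //; left.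
Qed.

End Runs.

(** * Bounded letters and bounded tails *)

Section Words.
Variables (A : finType) (phi : substitution A).
Implicit Types (a b c : A) (u v w s t : seq A).

Lemma subst_word_cat u v :
  subst_word phi (u ++ v) = subst_word phi u ++ subst_word phi v.
Proof. by rewrite /subst_word map_cat flatten_cat. Qed.

Lemma subst_word1 a : subst_word phi [:: a] = phi a.
Proof. by rewrite /subst_word /= cats0. Qed.

Lemma subst_iter_cat n u v :
  subst_iter phi n (u ++ v) = subst_iter phi n u ++ subst_iter phi n v.
Proof. by elim: n => //= n IHn; rewrite IHn subst_word_cat. Qed.

Lemma subst_iter_cons n a w :
  subst_iter phi n (a :: w) = subst_iter phi n [:: a] ++ subst_iter phi n w.
Proof. by rewrite -cat1s subst_iter_cat. Qed.

Lemma subst_iter_nil n : subst_iter phi n [::] = [::].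
Proof. by elim: n => //= n ->. Qed.

Lemma subst_iterD m n w :
  subst_iter phi (m + n) w = subst_iter phi m (subst_iter phi n w).
Proof. exact: iterD. Qed.

Lemma subst_iterSr n a :
  subst_iter phi n.+1 [:: a] = subst_iter phi n (phi a).
Proof. by rewrite /subst_iter iterSr subst_word1. Qed.

Lemma size_subst_word w : size w <= size (subst_word phi w).
Proof.
elim: w => //= a w IHw; rewrite -cat1s subst_word_cat subst_word1 size_cat.
by rewrite -add1n leq_add // lt0n size_eq0 subst_neq_nil.
Qed.

Lemma size_subst_iter n w : size w <= size (subst_iter phi n w).
Proof. by elim: n => //= n /leq_trans; apply; exact: size_subst_word. Qed.

Definition bdd : pred A := fun a => `[< bounded_letter phi a >].

Lemma bddP a :
  reflect (exists M, forall n, size (subst_iter phi n [:: a]) <= M) (bdd a).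
Proof. by apply: (iffP (asboolP _)) => [[]|] //. Qed.

Lemma expandingE a : expanding_letter phi a <-> ~~ bdd a.
Proof.
split=> [[_ nb]|/asboolP nb]; last by split.
by apply/asboolP.
Qed.

Lemma bounded_iter_bound :
  exists M, forall n w, all bdd w -> size (subst_iter phi n w) <= M * size w.
Proof.
have [M MP] := @fin_uniform_bound A bdd
  (fun a n => size (subst_iter phi n [:: a])) (fun a => elimT (bddP a)).
exists M => n; elim=> [|a w IHw] /=; first by rewrite subst_iter_nil.
case/andP=> bdda bddw; rewrite subst_iter_cons size_cat mulnS.
by rewrite leq_add ?MP ?IHw.
Qed.

Lemma all_bdd_of_bound M w :
  (forall n, size (subst_iter phi n w) <= M) -> all bdd w.
Proof.
move=> leM; apply/allP => a a_w; case/splitPr: a_w leM => u v leM.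
apply/bddP; exists M => n; apply: leq_trans (leM n).
rewrite subst_iter_cat (subst_iter_cons _ _ v) !size_cat.
by rewrite addnCA leq_addr.
Qed.

(** Boundedness of a word is a condition on its letters: the alphabet is finite,
so bounded letters have a common bound. *)
Lemma bounded_wordE w : bounded_word phi w <-> w != [::] /\ all bdd w.
Proof.
split=> [[w0 [M MP]]|[w0 bddw]]; split=> //; first exact: all_bdd_of_bound MP.
by have [M MP] := bounded_iter_bound; exists (M * size w) => n; exact: MP.
Qed.

Lemma all_bdd_iter n w : all bdd w -> all bdd (subst_iter phi n w).
Proof.
have [M MP] := bounded_iter_bound => bddw.
by apply: (@all_bdd_of_bound (M * size w)) => m; rewrite -subst_iterD MP.
Qed.

Lemma all_bdd_subst w : all bdd w -> all bdd (subst_word phi w).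
Proof. exact: (@all_bdd_iter 1). Qed.

Lemma expanding_image a : ~~ bdd a -> ~~ all bdd (phi a).
Proof.
apply: contra => bddpa; have [M MP] := bounded_iter_bound; apply/bddP.
exists (maxn 1 (M * size (phi a))) => -[|n]; first by rewrite leq_maxl.
by rewrite leq_max (subst_iterSr n a) MP ?orbT.
Qed.

(** The longest suffix of w made of bounded letters. *)
Definition bounded_tail w : seq A :=
  foldl (fun s c => if bdd c then rcons s c else [::]) [::] w.

(** The default a is only returned when w has no expanding letter; passing it
explicitly lets [last_expanding] be threaded through a concatenation, as in
[last_expanding_cat]. *)
Definition last_expanding a w : A := last a (filter (predC bdd) w).

Definition next_expanding a : A := last_expanding a (phi a).

Lemma bounded_tail_rcons w c :
  bounded_tail (rcons w c) = if bdd c then rcons (bounded_tail w) c else [::].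
Proof. by rewrite /bounded_tail foldl_rcons. Qed.

Lemma bounded_tail_cat u v :
  bounded_tail (u ++ v) =
    if all bdd v then bounded_tail u ++ v else bounded_tail v.
Proof.
elim/last_ind: v => [|v c IHv]; first by rewrite !cats0.
rewrite -rcons_cat !bounded_tail_rcons IHv all_rcons; case: (bdd c) => //=.
by case: ifP => // _; rewrite rcons_cat.
Qed.

Lemma bounded_tail_all w : all bdd (bounded_tail w).
Proof.
elim/last_ind: w => // w c IHw; rewrite bounded_tail_rcons.
by case: ifP => // bc; rewrite all_rcons bc.
Qed.

Lemma size_bounded_tail w : size (bounded_tail w) <= size w.
Proof.
elim/last_ind: w => // w c IHw; rewrite bounded_tail_rcons.
by case: ifP => // bc; rewrite !size_rcons ltnS.
Qed.

Lemma bounded_tail_neq0 a w :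
  w != [::] -> (bounded_tail w != [::]) = bdd (last a w).
Proof.
case/lastP: w => // w c _; rewrite bounded_tail_rcons last_rcons.
by case: ifP => // _; case: (bounded_tail w).
Qed.

Lemma size_suffix_tail u v :
  all bdd v -> size v <= size (bounded_tail (u ++ v)).
Proof. by move=> bv; rewrite bounded_tail_cat bv size_cat leq_addl. Qed.

Lemma last_expanding_cat a u v :
  last_expanding a (u ++ v) = last_expanding (last_expanding a u) v.
Proof. by rewrite /last_expanding filter_cat last_cat. Qed.

Lemma last_expanding_all a w : all bdd w -> last_expanding a w = a.
Proof.
move=> bw; rewrite /last_expanding (_ : filter _ _ = [::]) //.
by apply/eqP; rewrite -size_eq0 size_filter -leqn0
leqNgt -has_count has_predC bw.
Qed.

Lemma last_expanding_default a b w :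
  ~~ all bdd w -> last_expanding a w = last_expanding b w.
Proof.
rewrite -has_predC has_filter /last_expanding.
by case: (filter _ w).
Qed.

Lemma split_last_expanding a w : ~~ all bdd w ->
  ~~ bdd (last_expanding a w) /\
  exists p, w = p ++ last_expanding a w :: bounded_tail w.
Proof.
elim/last_ind: w => // w c IHw; rewrite all_rcons bounded_tail_rcons -!cats1.
rewrite last_expanding_cat; have [bc|nbc] := boolP (bdd c) => /= [nbw|_].
  rewrite last_expanding_all /= ?bc //; have [nb [p def_w]] := IHw nbw.
  by split=> //; exists p; rewrite {1}def_w -catA.
by rewrite /last_expanding /= nbc /=; split=> //; exists w.
Qed.

(** The recursion behind the whole proof: the image of the bounded tail stays
bounded, so the last expanding letter of the image comes from c, and the new
tail is the image of the old one preceded by the tail of phi(c). *)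
Lemma subst_word_split a p c t : ~~ bdd c -> all bdd t ->
  let w := subst_word phi (p ++ c :: t) in
  last_expanding a w = next_expanding c /\
  bounded_tail w = bounded_tail (phi c) ++ subst_word phi t.
Proof.
move=> nbc bt /=; have btt := all_bdd_subst bt.
rewrite subst_word_cat -cat1s subst_word_cat subst_word1.
have nbpc := expanding_image nbc; split.
  rewrite !last_expanding_cat [RHS in _ = RHS]/next_expanding.
  by rewrite [LHS]last_expanding_all //; apply: last_expanding_default.
by rewrite catA bounded_tail_cat btt bounded_tail_cat (negPf nbpc).
Qed.

Lemma expanding_orbit a n : ~~ bdd a ->
  [/\ ~~ all bdd (subst_iter phi n [:: a]),
      ~~ bdd (iter n next_expanding a)
    & last_expanding a (subst_iter phi n [:: a]) = iter n next_expanding a].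
Proof.
move=> nba; elim: n => [|n [nbw nbc lw]].
  by rewrite /= /last_expanding /= (negPf nba).
have [_ [p def_w]] := split_last_expanding a nbw; rewrite lw in def_w.
have [lw1 _] := subst_word_split a p nbc
  (bounded_tail_all (subst_iter phi n [:: a])).
rewrite -def_w in lw1; rewrite /= lw1.
suff nb1 : ~~ all bdd (subst_word phi (subst_iter phi n [:: a])).
  by split=> //; rewrite -lw1; case: (split_last_expanding a nb1).
rewrite def_w subst_word_cat -cat1s subst_word_cat subst_word1 !all_cat.
by rewrite (negPf (expanding_image nbc)) /= andbF.
Qed.

Lemma split_orbit a n : ~~ bdd a ->
  exists p, subst_iter phi n [:: a] =
    p ++ iter n next_expanding a :: bounded_tail (subst_iter phi n [:: a]).
Proof.
move=> nba; have [nbw _ <-] := expanding_orbit n nba.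
by case: (split_last_expanding a nbw).
Qed.

Lemma A_rightE a : A_right phi a <-> ~~ bdd a /\ bounded_tail (phi a) != [::].
Proof.
rewrite (bounded_tail_neq0 a (subst_neq_nil phi a)).
by split=> -[/expandingE nba /asboolP bl].
Qed.

Lemma rightmost_expandingE a b w : ~~ all bdd w ->
  rightmost_expanding phi w b <-> last_expanding a w = b.
Proof.
move=> nbw; split=> [[u [v [-> /expandingE nbb nev]]]|<-].
  have bv : all bdd v.
    by apply/allP => c /nev; apply: contra_notT => nbc; apply/expandingE.
  rewrite -cat1s catA last_expanding_cat last_expanding_all //.
  by rewrite last_expanding_cat /last_expanding /= nbb.
have [nbl [p def_w]] := split_last_expanding a nbw.
exists p, (bounded_tail w); split=> //; first exact/expandingE.
by move=> c /(allP (bounded_tail_all w)) bc /expandingE; rewrite bc.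
Qed.

(** In a finite set, the letters that an orbit visits infinitely often are those
of its limit cycle. *)
Lemma star_right_periodic : star_right phi <->
  exists b p, [/\ A_right phi b, 0 < p & iter p next_expanding b = b].
Proof.
split=> [[a /A_rightE[nba _] [N homoN starN]]|[b [p [Rb p_gt0 per_b]]]].
  have leN i : i <= N i.
    by elim: i => // i /leq_ltn_trans; apply; exact: homoN.
  have [b rb Rb] := starN #|A|; have [nbw _ lw] := expanding_orbit (N #|A|) nba.
  move/(rightmost_expandingE a b nbw): rb; rewrite lw => def_b.
  have [p p_gt0] := iter_periodic next_expanding a (leN #|A|).
  by rewrite def_b => per_b; exists b, p.
have /A_rightE[nbb _] := Rb.
exists b => //; exists (fun i => i * p) => [i j|i].
  by rewrite ltn_mul2r p_gt0.
exists b => //; have [nbw _ lw] := expanding_orbit (i * p) nbb.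
by apply/(rightmost_expandingE b b nbw); rewrite lw iterM; apply: iter_fix.
Qed.

(** * From property star to wildness *)

(** The finitary witness of wildness; unlike property star it is left-right
symmetric. *)
Definition admits_powers :=
  exists w, [/\ w != [::], all bdd w
    & forall m, admitted phi (flatten (nseq m w))].

(** The suffix T psi(T) ... psi^(n-1)(T) of phi^(pn)(b), where psi = phi^p, is
eventually periodic, because the words psi^k(T) are bounded in length. *)
Lemma periodic_right_powers b p :
    A_right phi b -> 0 < p -> iter p next_expanding b = b ->
  admits_powers.
Proof.
move=> /A_rightE[nbb tb] p_gt0 per_b.
have [P] := split_orbit p nbb; rewrite per_b.
set T := bounded_tail _ => defP; have bT : all bdd T by exact: bounded_tail_all.
have T0 : T != [::].
  (* T ends with the image under phi^(p-1) of the nonempty tail of phi(b). *)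
  rewrite /T -(prednK p_gt0) subst_iterSr.
  have [_ [q ->]] := split_last_expanding b (expanding_image nbb).
  rewrite -cat1s catA subst_iter_cat bounded_tail_cat
    all_bdd_iter ?bounded_tail_all //.
  rewrite -size_eq0 size_cat -lt0n addn_gt0 orbC.
  by rewrite (leq_trans _ (size_subst_iter _ _)) // lt0n size_eq0.
pose f n := subst_iter phi (n * p) T.
have tails n : exists Q,
    subst_iter phi (n * p) [:: b] = Q ++ b :: flatten (mkseq f n).
  elim: n => [|n [Q defQ]]; first by exists [::].
  rewrite mulSnr subst_iterD defP subst_iter_cat subst_iter_cons defQ.
  exists (subst_iter phi (n * p) P ++ Q).
  by rewrite mkseqS flatten_rcons -!catA.
have [M MP] := bounded_iter_bound.
have [i [j [ltij eqij]]] := bounded_sequence_repeats (fun n => MP (n * p) T bT).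
(* From i on the sequence f has period d, so w is one full period of it. *)
pose d := j - i; have d_gt0 : 0 < d by rewrite subn_gt0.
have perf k : f (d + (i + k)) = f (i + k).
  rewrite addnA subnK 1?ltnW // /f ![_ + k]addnC !mulnDl !subst_iterD.
  by rewrite eqij.
pose w := flatten [seq f k | k <- iota i d].
have powers m : flatten [seq f k | k <- iota i (m * d)] = flatten (nseq m w).
  elim: m => // m IHm; rewrite mulSn iotaD map_cat flatten_cat /= -IHm.
  congr (_ ++ flatten _).
  have -> : i + d = d + (i + 0) by rewrite addn0 addnC.
  rewrite iotaDl -{2}[i]addn0 !iotaDl -!map_comp; apply: eq_map => k /=.
  exact: perf.
exists w; split=> [||m].
- rewrite /w -(prednK d_gt0) /= -size_eq0 size_cat -lt0n addn_gt0.
  by rewrite (leq_trans _ (size_subst_iter _ _)) // lt0n size_eq0.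
- rewrite /w; elim: (iota i d) => //= k s IHs.
  by rewrite all_cat all_bdd_iter.
have [Q defQ] := tails (i + m * d).
exists b, ((i + m * d) * p); rewrite defQ /mkseq iotaD map_cat flatten_cat.
by rewrite -powers add0n -cat1s !catA suffix_infix.
Qed.

Lemma nth_power a w m k : k < m * size w ->
  nth a (flatten (nseq m w)) k = nth a w (k %% size w).
Proof.
elim: m k => // m IHm k; rewrite mulSn => ltk /=; rewrite nth_cat.
case: ltnP => [ltkw|lewk]; first by rewrite modn_small.
by rewrite IHm ?ltn_subLR // -{2}(subnKC lewk) modnDl.
Qed.

Lemma size_power w m : size (flatten (nseq m w)) = m * size w.
Proof. by elim: m => //= m IHm; rewrite size_cat IHm mulSn. Qed.

Definition periodic_sequence a w (i : int) : A :=
  nth a w (absz (modz i (size w)%:Z)%R).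

Lemma block_periodic_sequence a w i n : w != [::] ->
  exists m, infix (block (periodic_sequence a w) i n) (flatten (nseq m w)).
Proof.
rewrite -size_eq0 -lt0n => w_gt0.
pose r := absz (modz i (size w)%:Z)%R.
have def_r : modz i (size w)%:Z%R = r%:Z%R.
  by rewrite /r gez0_abs // modz_ge0 // eqz_nat -lt0n.
(* Any exponent m with r + n <= m * size w would do. *)
pose W := flatten (nseq (r + n).+1 w); exists (r + n).+1; rewrite -/W.
have leW : r + n <= size W.
  by rewrite size_power (leq_trans (leqnSn _)) // leq_pmulr.
suff -> : block (periodic_sequence a w) i n = take n (drop r W).
  by apply: infix_trans (infix_take _ _) (infix_drop _ _).
have size_r : size (take n (drop r W)) = n.
  by apply: size_takel; rewrite size_drop leq_subRL //; lia.
apply: (@eq_from_nth _ a) => [|j]; rewrite size_mkseq ?size_r // => ltjn.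
rewrite nth_mkseq // nth_take // nth_drop nth_power; last first.
  by rewrite -size_power; apply: leq_trans leW; rewrite ltn_add2l.
by rewrite /periodic_sequence -modzDml def_r -PoszD modz_nat absz_nat.
Qed.

Lemma block_inj (x : int -> A) i : injective (block x i).
Proof. by move=> m n /(congr1 size); rewrite !size_mkseq. Qed.

(** Every block of the bi-infinite repetition of w is a factor of a power of w,
hence admitted. *)
Lemma wild_of_powers : admits_powers -> wild phi.
Proof.
case=> v [v0 bv admv]; have [a _] : exists a, a \in v.
  by case: v v0 {bv admv} => // a w _; exists a; exact: mem_head.
pose x := periodic_sequence a v.
have blocks i n : exists m, infix (block x i n) (flatten (nseq m v)).
  exact: block_periodic_sequence.
have Xx : subshift phi x.
  move=> i n; have [m infm] := blocks i n; have [b [k admm]] := admv m.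
  by exists b, k; apply: infix_trans admm.
move=> finB; apply: infinite_nat.
have inj : injective (fun n => block x 0 n.+1) by move=> m n /block_inj[].
apply: sub_finite_set (finite_preimage (in2W inj) finB) => n _; split.
  apply/bounded_wordE; split; first by rewrite -size_eq0 size_mkseq.
  have [m infm] := blocks 0%R n.+1; apply/allP => c /(mem_infix infm).
  by case/flattenP => s /nseqP[-> _]; exact: (allP bv).
by exists x => //; exists 0%R, n.+1.
Qed.

(** * From wildness to property star *)

(** After #|A| steps the orbit of a has reached a cycle; without the right half
of property star no letter of this cycle contributes to the tail, whose further
growth is that of the iterated images of one bounded word. *)
Lemma bounded_tail_bounded : ~ star_right phi ->
  exists C, forall a n, size (bounded_tail (subst_iter phi n [:: a])) <= C.
Proof.
move=> nstar; have [M MP] := bounded_iter_bound.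
suff bound a : ~~ bdd a ->
    exists C, forall n, size (bounded_tail (subst_iter phi n [:: a])) <= C.
  have [C CP] := fin_uniform_bound bound; exists (maxn M C) => a n.
  rewrite leq_max; have [bdda|nba] := boolP (bdd a); last by rewrite CP ?orbT.
  rewrite (leq_trans (size_bounded_tail _)) //.
  by rewrite -[M]muln1 (MP n [:: a]) //= bdda.
move=> nba; pose K := #|A|; pose w := subst_iter phi K [:: a].
have tailK m : bounded_tail (subst_iter phi (m + K) [:: a]) =
               subst_iter phi m (bounded_tail w).
  elim: m => // m IHm; have [_ nbc _] := expanding_orbit (m + K) nba.
  have [p p_gt0 per] := iter_periodic next_expanding a (leq_addl m K).
  have [q def_q] := split_orbit (m + K) nba.
  have := subst_word_split a q nbc
    (bounded_tail_all (subst_iter phi (m + K) [:: a])).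
  rewrite /= -def_q => -[_ ->].
  rewrite [X in X ++ _](_ : _ = [::]) ?IHm //; apply: contrapT => /eqP tc.
  apply: nstar; apply/star_right_periodic.
  by exists (iter (m + K) next_expanding a), p; split=> //; apply/A_rightE.
exists (maxn (M * size (bounded_tail w)) (size w)) => n; rewrite leq_max.
have [leKn|ltnK] := leqP K n.
  by rewrite -(subnK leKn) tailK MP ?bounded_tail_all.
rewrite orbC (leq_trans (size_bounded_tail _)) // /w -(subnK (ltnW ltnK)).
by rewrite subst_iterD size_subst_iter.
Qed.

Lemma suffix_run_bounded : ~ star_right phi ->
  exists C, forall a n u,
    all bdd u -> suffix u (subst_iter phi n [:: a]) -> size u <= C.
Proof.
move=> /bounded_tail_bounded[C CP]; exists C => a n u bu /suffixP[v def_w].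
by apply: leq_trans (CP a n); rewrite def_w size_suffix_tail.
Qed.

Lemma subst_iter_flatten n w :
  subst_iter phi n w = flatten [seq subst_iter phi n [:: a] | a <- w].
Proof.
elim: w => [|a w IHw] /=; first exact: subst_iter_nil.
by rewrite subst_iter_cons IHw.
Qed.

(** Bounds on bounded prefixes and suffixes propagate to all bounded runs with a
bound D independent of n: a run straddling several of the words phi^n(c),
for c in phi(a), is controlled by its ends, and the other runs by induction. *)
Lemma run_bounded C :
    (forall a n u, all bdd u ->
       prefix u (subst_iter phi n [:: a]) \/
       suffix u (subst_iter phi n [:: a]) -> size u <= C) ->
  exists D, forall a n u,
    all bdd u -> infix u (subst_iter phi n [:: a]) -> size u <= D.
Proof.
move=> endsC; exists (maxn 1 (C * \max_a size (phi a))) => a n.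
elim: n a => [|n IHn] a u bu inf_u.
  by rewrite leq_max (size_infix inf_u).
rewrite subst_iterSr subst_iter_flatten in inf_u.
apply: (@flatten_run_bound _ bdd C) inf_u => // [s|s|].
- by case/mapP=> c _ -> v bv ends_v; exact: endsC bv ends_v.
- by case/mapP=> c _ ->; exact: IHn.
by rewrite size_map leq_max leq_mul ?orbT //; apply: leq_bigmax.
Qed.

End Words.

(** * Left-right symmetry *)

Section Reversal.
Variables (A : finType) (phi : substitution A).

Lemma rev_subst_neq_nil a : rev (phi a) != [::].
Proof. by rewrite -size_eq0 size_rev size_eq0 subst_neq_nil. Qed.

Definition rev_subst : substitution A := Substitution rev_subst_neq_nil.

Lemma rev_subst_iter n w :
  subst_iter rev_subst n (rev w) = rev (subst_iter phi n w).
Proof.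
elim: n => //= n ->; elim: (subst_iter phi n w) => //= a s IHs.
rewrite rev_cons -cats1 subst_word_cat IHs subst_word1 /=.
by rewrite -cat1s subst_word_cat subst_word1 rev_cat.
Qed.

Lemma rev_subst_iter1 n a :
  subst_iter rev_subst n [:: a] = rev (subst_iter phi n [:: a]).
Proof. exact: (rev_subst_iter n [:: a]). Qed.

Lemma rev_bounded_letter a : bounded_letter rev_subst a = bounded_letter phi a.
Proof.
rewrite /bounded_letter /bounded_word /=; congr (_ /\ _).
apply: eq_exists => M; apply: eq_forall => n.
by rewrite rev_subst_iter1 size_rev.
Qed.

Lemma rev_bdd : bdd rev_subst = bdd phi.
Proof. by apply/funext => a; rewrite /bdd rev_bounded_letter. Qed.

Lemma rev_expanding_letter a :
  expanding_letter rev_subst a <-> expanding_letter phi a.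
Proof. by rewrite !expandingE rev_bdd. Qed.

Lemma rev_A_right a : A_right rev_subst a <-> A_left phi a.
Proof.
rewrite /A_right /A_left /= rev_expanding_letter.
suff -> : last a (rev (phi a)) = head a (phi a) by rewrite rev_bounded_letter.
by case: (phi a) => //= b s; rewrite rev_cons last_rcons.
Qed.

Lemma rev_rightmost_expanding w b :
  rightmost_expanding rev_subst (rev w) b <-> leftmost_expanding phi w b.
Proof.
split=> -[u [v [def_w /rev_expanding_letter xb nx]]]; exists (rev v), (rev u).
  split=> //; first by rewrite -[w]revK def_w rev_cat rev_cons cat_rcons.
  by move=> c; rewrite mem_rev => /nx nxc /rev_expanding_letter.
split=> //; first by rewrite def_w rev_cat rev_cons cat_rcons.
by move=> c; rewrite mem_rev => /nx nxc /rev_expanding_letter.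
Qed.

Lemma rev_star_right : star_right rev_subst <-> star_left phi.
Proof.
split=> -[a /rev_A_right La [N homoN starN]]; exists a => //.
  exists N => // i; have [b rb Rb] := starN i; exists b; last exact/rev_A_right.
  by apply/rev_rightmost_expanding; rewrite -rev_subst_iter1.
exists N => // i; have [b rb Rb] := starN i; exists b; last exact/rev_A_right.
by rewrite rev_subst_iter1; apply/rev_rightmost_expanding.
Qed.

Lemma rev_admits_powers : admits_powers rev_subst -> admits_powers phi.
Proof.
case=> w [w0 bw admw]; exists (rev w); split=> [||m].
- by rewrite -size_eq0 size_rev size_eq0.
- by rewrite all_rev -rev_bdd.
have [a [k]] := admw m; rewrite rev_subst_iter1 => inf_w; exists a, k.
suff -> : flatten (nseq m (rev w)) = rev (flatten (nseq m w)).
  by rewrite infix_revLR.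
by rewrite rev_flatten map_nseq rev_nseq.
Qed.

End Reversal.

(** * The equivalence *)

Lemma star_right_powers (A : finType) (phi : substitution A) :
  star_right phi -> admits_powers phi.
Proof.
case/star_right_periodic => b [p [Rb p_gt0 per_b]].
exact: periodic_right_powers Rb p_gt0 per_b.
Qed.

Lemma bounded_admitted_short (A : finType) (phi : substitution A) :
    ~ property_star phi ->
  exists D, forall u, all (bdd phi) u -> admitted phi u -> size u <= D.
Proof.
case/not_orP => nright nleft.
have [C1 sufC] := suffix_run_bounded nright.
have [C2 preC] : exists C, forall a n u, all (bdd (rev_subst phi)) u ->
    suffix u (subst_iter (rev_subst phi) n [:: a]) -> size u <= C.
  by apply: suffix_run_bounded => /rev_star_right.
have [|D runD] := @run_bounded A phi (maxn C1 C2).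
  move=> a n u bu [pre|suf]; rewrite leq_max; last by rewrite (sufC a n).
  rewrite orbC -size_rev (preC a n) // ?rev_bdd ?all_rev //.
  by rewrite rev_subst_iter1 suffix_rev.
by exists D => u bu [a [k]]; exact: runD.
Qed.

Theorem theorem2p9 (A : finType) (phi : substitution A) :
  wild phi <-> property_star phi.
Proof.
split=> [wild_phi|[/star_right_powers|/rev_star_right]].
- apply: contrapT => /bounded_admitted_short[D leD]; apply: wild_phi.
  apply: sub_finite_set (finite_short_words A D) => u [].
  case/bounded_wordE=> _ bu [x Xx [i [n def_u]]].
  by apply: leD => //; rewrite def_u; exact: Xx.
- exact: wild_of_powers.
by move/star_right_powers/rev_admits_powers; exact: wild_of_powers.
Qed.
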